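(* Let $A$ be a $k$-algebra and let $s\colon C\otimes A\to A\otimes C$ be a $k$-linear map, with associated maps $\gamma^r_j\colon A\to A$ ($r\ge 0$, $0\le j<n$). The following assertions are equivalent: (1) The map $s$ is a twisting map. (2) (a) $\gamma^0_j=\delta_{j0}\,\mathrm{id}$; (b) $\gamma^r_j(1)=\delta_{jr}$; (c) for $j<n$ and $0<r<n$, $\gamma^r_j(ab)=\sum_{i=0}^{n-1}\gamma^r_i(a)\gamma^i_j(b)$ for all $a,b\in A$ (Product law); (d) for $j<n$, $r>1$ and $0<i<r$, $\gamma^r_j=\sum_{l=0}^{j}\gamma^i_l\circ\gamma^{r-i}_{j-l}$ (Composition law). (3) (a) $\gamma^0_j=\delta_{j0}\,\mathrm{id}$; (b) $\gamma^1_j(1)=\delta_{j1}$; (c) for $j<n$, $\gamma^1_j(ab)=\sum_{i=0}^{n-1}\gamma^1_i(a)\gamma^i_j(b)$ for all $a,b\in A$; (d) for $j<n$ and $r>1$, $\gamma^r_j=\sum_{l=0}^{j}\gamma^1_l\circ\gamma^{r-1}_{j-l}$.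
   Context: $k$ is a commutative ring; all algebras are associative unital $k$-algebras, all maps are $k$-linear and $\otimes$ means $\otimes_k$. $n\ge 1$ is an integer and $C:=k[y]/\langle y^n\rangle$. A twisting map is a $k$-linear map $s\colon C\otimes A\to A\otimes C$ such that (1) $s(1\otimes a)=a\otimes 1$ and $s(c\otimes 1)=1\otimes c$ for all $a\in A$, $c\in C$; (2) $s\circ(\mu_C\otimes A)=(A\otimes\mu_C)\circ(s\otimes C)\circ(C\otimes s)$; (3) $s\circ(C\otimes\mu_A)=(\mu_A\otimes C)\circ(A\otimes s)\circ(s\otimes A)$, where $\mu_A,\mu_C$ are the multiplication maps and an algebra symbol also denotes its identity map. A $k$-linear map $s\colon C\otimes A\to A\otimes C$ determines $k$-linear maps $\gamma^r_j\colon A\to A$ by $s(y^r\otimes a)=\sum_{j=0}^{n-1}\gamma^r_j(a)\otimes y^j$ for $0\le r<n$, and one sets $\gamma^r_j:=0$ for $r\ge n$, $0\le j<n$. $\delta$ is the Kronecker delta. *)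

(* Defs.v *)
From HB Require Import structures.
From mathcomp Require Import all_boot all_algebra.
From mathcomp Require Import boolp.

Set Implicit Arguments.
Unset Strict Implicit.
Unset Printing Implicit Defensive.

Import GRing.Theory.
Local Open Scope ring_scope.
Local Open Scope quotient_scope.

(******************************************************************************)
(* Tensor product of two modules over a commutative ring k: finite formal     *)
(* sums of pairs (lists, with concatenation as addition) modulo the smallest  *)
(* additive congruence making the pairing k-bilinear.  The universal property *)
(* is given by tens_lift, tens_liftE and tens_ext below.                      *)
(******************************************************************************)
Section Tensor.
Variables (k : comNzRingType) (M N : lmodType k).
Local Notation word := (seq (M * N)).
Implicit Types (u v w : word) (m : M) (n : N) (a b c : k).

Inductive tens_rel : word -> word -> Prop :=
| tens_rel_refl u : tens_rel u u
| tens_rel_sym u v : tens_rel u v -> tens_rel v u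
| tens_rel_trans v u w : tens_rel u v -> tens_rel v w -> tens_rel u w
| tens_rel_cat u u' v v' :
    tens_rel u u' -> tens_rel v v' -> tens_rel (u ++ v) (u' ++ v')
| tens_rel_catC u v : tens_rel (u ++ v) (v ++ u)
| tens_rel_0l n : tens_rel [:: (0, n)] [::]
| tens_rel_Dl m m' n : tens_rel [:: (m + m', n)] [:: (m, n); (m', n)]
| tens_rel_Dr m n n' : tens_rel [:: (m, n + n')] [:: (m, n); (m, n')]
| tens_rel_Z c m n : tens_rel [:: (c *: m, n)] [:: (m, c *: n)].

Definition tens_relb u v : bool := `[< tens_rel u v >].

Lemma tens_relb_refl : reflexive tens_relb.
Proof. by move=> u; apply/asboolP; exact: tens_rel_refl. Qed.

Lemma tens_relb_sym : symmetric tens_relb.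
Proof.
by move=> u v; apply/idP/idP => /asboolP uv; apply/asboolP; exact: tens_rel_sym.
Qed.

Lemma tens_relb_trans : transitive tens_relb.
Proof.
move=> v u w /asboolP uv /asboolP vw; apply/asboolP.
exact: tens_rel_trans uv vw.
Qed.

Canonical tens_equiv :=
  EquivRel tens_relb tens_relb_refl tens_relb_sym tens_relb_trans.

Definition tens := {eq_quot tens_relb}.

HB.instance Definition _ := Choice.on tens.
HB.instance Definition _ := EqQuotient.on tens.

Definition mktens u : tens := \pi_tens u.

Lemma mktensW (Q : tens -> Prop) : (forall u, Q (mktens u)) -> forall x, Q x.
Proof. by move=> Qpi; elim/quotW => u; exact: Qpi. Qed.

Lemma tens_eqP u v : tens_rel u v <-> mktens u = mktens v.
Proof.
by split=> [uv|/eqmodP/asboolP//]; apply/eqmodP/asboolP.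
Qed.

Lemma tens_reprP u : tens_rel (repr (mktens u)) u.
Proof. by apply/tens_eqP; rewrite /mktens reprK. Qed.

Definition word_scale c u : word := [seq (c *: x.1, x.2) | x <- u].

Lemma word_scale_rel c u v :
  tens_rel u v -> tens_rel (word_scale c u) (word_scale c v).
Proof.
rewrite /word_scale; elim=> {u v} /=.
- by move=> u; exact: tens_rel_refl.
- by move=> u v _; exact: tens_rel_sym.
- by move=> v u w _ uv _; exact: tens_rel_trans.
- by move=> u u' v v' _ uu' _ vv'; rewrite !map_cat; exact: tens_rel_cat.
- by move=> u v; rewrite !map_cat; exact: tens_rel_catC.
- by move=> n; rewrite scaler0; exact: tens_rel_0l.
- by move=> m m' n; rewrite scalerDr; exact: tens_rel_Dl.
- by move=> m n n'; exact: tens_rel_Dr.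
- by move=> b m n; rewrite scalerA mulrC -scalerA; exact: tens_rel_Z.
Qed.

Lemma word_scaleDl a b u :
  tens_rel (word_scale (a + b) u) (word_scale a u ++ word_scale b u).
Proof.
elim: u => [|[m n] u IH] /=; first exact: tens_rel_refl.
apply: (@tens_rel_trans ([:: (a *: m, n); (b *: m, n)] ++
                         (word_scale a u ++ word_scale b u))).
  rewrite -cat1s; apply: tens_rel_cat => //.
  by rewrite scalerDl; exact: tens_rel_Dl.
rewrite -[X in tens_rel _ X]/([:: (a *: m, n)] ++ _).
rewrite -[X in tens_rel X _]/([:: (a *: m, n)] ++ ([:: (b *: m, n)] ++ _)).
apply: tens_rel_cat; first exact: tens_rel_refl.
rewrite -[(b *: m, n) :: word_scale b u]cat1s !catA.
by apply: tens_rel_cat; [exact: tens_rel_catC|exact: tens_rel_refl].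
Qed.

Lemma word_scale0 u : tens_rel (word_scale 0 u) [::].
Proof.
elim: u => [|[m n] u IH] /=; first exact: tens_rel_refl.
rewrite scale0r -cat1s -[X in tens_rel _ X]/([::] ++ [::]).
by apply: tens_rel_cat => //; exact: tens_rel_0l.
Qed.

Lemma word_scale1 u : word_scale 1 u = u.
Proof. by elim: u => //= -[m n] u ->; rewrite scale1r. Qed.

Definition tens_add (x y : tens) : tens := locked (mktens (repr x ++ repr y)).
Definition tens_zero : tens := mktens [::].
Definition tens_scale c (x : tens) : tens :=
  locked (mktens (word_scale c (repr x))).
Definition tens_opp : tens -> tens := tens_scale (- 1).

Lemma mktens_add u v : tens_add (mktens u) (mktens v) = mktens (u ++ v).
Proof.
rewrite /tens_add -lock.
by apply/tens_eqP; apply: tens_rel_cat; exact: tens_reprP. Qed.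

Lemma mktens_scale c u : tens_scale c (mktens u) = mktens (word_scale c u).
Proof.
rewrite /tens_scale -lock.
by apply/tens_eqP; apply: word_scale_rel; exact: tens_reprP. Qed.

Lemma tens_addA : associative tens_add.
Proof.
by elim/mktensW=> u; elim/mktensW=> v; elim/mktensW=> w; rewrite !mktens_add catA.
Qed.

Lemma tens_addC : commutative tens_add.
Proof.
elim/mktensW=> u; elim/mktensW=> v; rewrite !mktens_add.
by apply/tens_eqP; exact: tens_rel_catC.
Qed.

Lemma tens_add0 : left_id tens_zero tens_add.
Proof. by elim/mktensW=> u; rewrite mktens_add. Qed.

Lemma tens_addN : left_inverse tens_zero tens_opp tens_add.
Proof.
elim/mktensW=> u; rewrite /tens_opp mktens_scale mktens_add.
apply/tens_eqP; rewrite -{2}[u]word_scale1.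
apply: tens_rel_trans (word_scale0 u); rewrite -[0](addNr (1 : k)).
by apply: tens_rel_sym; exact: word_scaleDl.
Qed.

HB.instance Definition _ :=
  GRing.isZmodule.Build tens tens_addA tens_addC tens_add0 tens_addN.

Lemma tens_scaleA a b x : tens_scale a (tens_scale b x) = tens_scale (a * b) x.
Proof.
elim/mktensW: x => u; rewrite !mktens_scale /word_scale -map_comp.
by congr (mktens _); apply: eq_map => x /=; rewrite scalerA.
Qed.

Lemma tens_scale1 : left_id 1 tens_scale.
Proof. by elim/mktensW=> u; rewrite mktens_scale word_scale1. Qed.

Lemma tens_scaleDr : right_distributive tens_scale +%R.
Proof.
move=> c; elim/mktensW=> u; elim/mktensW=> v.
rewrite [mktens u + _]mktens_add !mktens_scale [RHS]mktens_add.
by rewrite /word_scale map_cat.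
Qed.

Lemma tens_scaleDl x : {morph tens_scale^~ x : a b / a + b}.
Proof.
move=> a b; elim/mktensW: x => u; rewrite !mktens_scale [RHS]mktens_add.
by apply/tens_eqP; exact: word_scaleDl.
Qed.

HB.instance Definition _ := GRing.Zmodule_isLmodule.Build k tens
  tens_scaleA tens_scale1 tens_scaleDr tens_scaleDl.

Definition tensor m n : tens := mktens [:: (m, n)].

Lemma tensor_is_bilinear : bilinear_for *:%R *:%R tensor.
Proof.
have scaleE c m n : c *: tensor m n = mktens [:: (c *: m, n)].
  by rewrite [LHS]mktens_scale.
have addE u v : mktens u + mktens v = mktens (u ++ v) by exact: mktens_add.
split=> [n c m m' | m c n n'] /=; rewrite /applyr /= scaleE addE.
  by apply/tens_eqP; exact: tens_rel_Dl.
apply/tens_eqP; apply: tens_rel_trans (tens_rel_Dr _ _ _) _.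
rewrite -cat1s -[X in tens_rel _ X]cat1s.
apply: tens_rel_cat; last exact: tens_rel_refl.
by apply: tens_rel_sym; exact: tens_rel_Z.
Qed.

HB.instance Definition _ :=
  bilinear_isBilinear.Build k M N tens *:%R *:%R tensor tensor_is_bilinear.

Lemma tens_sum (x : tens) : exists u, x = \sum_(p <- u) tensor p.1 p.2.
Proof.
elim/mktensW: x => u; exists u; elim: u => [|[m n] u IH]; first by rewrite big_nil.
by rewrite big_cons -IH /= [RHS]mktens_add.
Qed.

Section Lift.
Variables (P : lmodType k) (f : {bilinear M -> N -> P}).

Definition word_lift u : P := \sum_(p <- u) f p.1 p.2.

Lemma word_lift_rel u v : tens_rel u v -> word_lift u = word_lift v.
Proof.
rewrite /word_lift; elim=> {u v} //.
- by move=> u v w _ -> _ ->.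
- by move=> u u' v v' _ uu' _ vv'; rewrite !big_cat /= uu' vv'.
- by move=> u v; rewrite !big_cat /= addrC.
- by move=> n; rewrite big_seq1 big_nil linear0l.
- by move=> m m' n; rewrite !big_cons !big_nil !addr0 linearDl.
- by move=> m n n'; rewrite !big_cons !big_nil !addr0 linearDr.
- by move=> c m n; rewrite !big_seq1 linearZl_LR linearZr_LR.
Qed.

Definition tens_lift (x : tens) : P := locked (word_lift (repr x)).

Lemma mktens_lift u : tens_lift (mktens u) = word_lift u.
Proof. by rewrite /tens_lift -lock; exact/word_lift_rel/tens_reprP. Qed.

Lemma tens_lift_is_linear : linear tens_lift.
Proof.
move=> c; elim/mktensW=> u; elim/mktensW=> v.
rewrite [c *: _]mktens_scale [_ + _]mktens_add !mktens_lift.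
rewrite /word_lift big_cat big_map /= scaler_sumr; congr (_ + _).
by apply: eq_bigr => p _; rewrite linearZl_LR.
Qed.

HB.instance Definition _ :=
  GRing.isLinear.Build k tens P *:%R tens_lift tens_lift_is_linear.

Lemma tens_liftE m n : tens_lift (tensor m n) = f m n.
Proof. by rewrite mktens_lift /word_lift big_seq1. Qed.

End Lift.

Lemma tens_ext (P : lmodType k) (f g : {linear tens -> P}) :
  (forall m n, f (tensor m n) = g (tensor m n)) -> f =1 g.
Proof.
move=> fg x; have [u ->] := tens_sum x.
by rewrite !linear_sum; apply: eq_bigr => p _; exact: fg.
Qed.

End Tensor.

Arguments tens {k} M N : rename.
Arguments tensor {k M N} m n : rename.

Notation "M ⊗ N" := (tens M%type N%type)
  (at level 40, left associativity).
Notation "m ⊗ₜ n" := (tensor m%R n%R)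
  (at level 40, left associativity).

Section TensorMaps.
Variable k : comNzRingType.

Section Map.
Variables (M M' N N' : lmodType k).
Variables (f : {linear M -> M'}) (g : {linear N -> N'}).

Definition tens_map_fun (m : M) (n : N) : M' ⊗ N' := f m ⊗ₜ g n.

Lemma tens_map_fun_is_bilinear : bilinear_for *:%R *:%R tens_map_fun.
Proof.
split=> [n c m m' | m c n n']; rewrite /applyr /tens_map_fun /= linearP.
  by rewrite linearPl.
by rewrite linearPr.
Qed.

HB.instance Definition _ := bilinear_isBilinear.Build k M N _ *:%R *:%R
  tens_map_fun tens_map_fun_is_bilinear.

Definition tens_map : {linear M ⊗ N -> M' ⊗ N'} := tens_lift tens_map_fun.

Lemma tens_mapE m n : tens_map (m ⊗ₜ n) = f m ⊗ₜ g n.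
Proof. exact: tens_liftE. Qed.

End Map.

Section Assoc.
Variables (M N P : lmodType k).

Section Inner.
Variables (m : M) (p : P).

Definition assoc_inner (x : M) (n : N) : M ⊗ (N ⊗ P) := x ⊗ₜ (n ⊗ₜ p).

Lemma assoc_inner_is_bilinear : bilinear_for *:%R *:%R assoc_inner.
Proof.
split=> [n c x x' | x c n n']; rewrite /applyr /assoc_inner /=.
  by rewrite linearPl.
by rewrite linearPl linearPr.
Qed.

HB.instance Definition _ := bilinear_isBilinear.Build k M N _
  *:%R *:%R assoc_inner assoc_inner_is_bilinear.

Definition unassoc_inner (n : N) (q : P) : (M ⊗ N) ⊗ P := (m ⊗ₜ n) ⊗ₜ q.

Lemma unassoc_inner_is_bilinear : bilinear_for *:%R *:%R unassoc_inner.
Proof.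
split=> [q c x x' | x c q q']; rewrite /applyr /unassoc_inner /=.
  by rewrite linearPr linearPl.
by rewrite linearPr.
Qed.

HB.instance Definition _ := bilinear_isBilinear.Build k N P _
  *:%R *:%R unassoc_inner unassoc_inner_is_bilinear.

End Inner.

Definition assoc_outer (t : M ⊗ N) (p : P) : M ⊗ (N ⊗ P) :=
  tens_lift (assoc_inner p) t.

Lemma assoc_outer_is_bilinear : bilinear_for *:%R *:%R assoc_outer.
Proof.
split=> [p c t t' | t c p p']; rewrite /applyr /assoc_outer /= ?linearP //.
have [u ->] := tens_sum t; rewrite ![tens_lift _ _]linear_sum scaler_sumr -big_split /=.
by apply: eq_bigr => x _; rewrite !tens_liftE /= /assoc_inner !linearPr.
Qed.

HB.instance Definition _ := bilinear_isBilinear.Build k _ P _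
  *:%R *:%R assoc_outer assoc_outer_is_bilinear.

Definition unassoc_outer (m : M) (t : N ⊗ P) : (M ⊗ N) ⊗ P :=
  tens_lift (unassoc_inner m) t.

Lemma unassoc_outer_is_bilinear : bilinear_for *:%R *:%R unassoc_outer.
Proof.
split=> [t c m m' | m c t t']; rewrite /applyr /unassoc_outer /= ?linearP //.
have [u ->] := tens_sum t; rewrite ![tens_lift _ _]linear_sum scaler_sumr -big_split /=.
by apply: eq_bigr => x _; rewrite !tens_liftE /= /unassoc_inner !linearPl.
Qed.

HB.instance Definition _ := bilinear_isBilinear.Build k M _ _
  *:%R *:%R unassoc_outer unassoc_outer_is_bilinear.

Definition tens_assoc : {linear (M ⊗ N) ⊗ P -> M ⊗ (N ⊗ P)} :=
  tens_lift assoc_outer.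

Definition tens_unassoc : {linear M ⊗ (N ⊗ P) -> (M ⊗ N) ⊗ P} :=
  tens_lift unassoc_outer.

Lemma tens_assocE m n p : tens_assoc ((m ⊗ₜ n) ⊗ₜ p) = m ⊗ₜ (n ⊗ₜ p).
Proof. by rewrite [LHS]tens_liftE /= /assoc_outer tens_liftE. Qed.

Lemma tens_unassocE m n p : tens_unassoc (m ⊗ₜ (n ⊗ₜ p)) = (m ⊗ₜ n) ⊗ₜ p.
Proof. by rewrite [LHS]tens_liftE /= /unassoc_outer tens_liftE. Qed.

End Assoc.

Section Mul.
Variable A : algType k.

Definition alg_mul (a b : A) : A := a * b.

Lemma alg_mul_is_bilinear : bilinear_for *:%R *:%R alg_mul.
Proof.
split=> [b c a a' | a c b b']; rewrite /applyr /alg_mul /=.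
  by rewrite mulrDl scalerAl.
by rewrite mulrDr scalerAr.
Qed.

HB.instance Definition _ := bilinear_isBilinear.Build k A A A *:%R *:%R
  alg_mul alg_mul_is_bilinear.

Definition tens_mul : {linear A ⊗ A -> A} := tens_lift alg_mul.

Lemma tens_mulE a b : tens_mul (a ⊗ₜ b) = a * b.
Proof. exact: tens_liftE. Qed.

End Mul.

End TensorMaps.

Arguments tens_assoc {k M N P}.
Arguments tens_unassoc {k M N P}.
Arguments tens_mul {k A}.

(* The canonical isomorphisms (U ⊗ V) ⊗ W ≅ U ⊗ (V ⊗ W), usually left         *)
(* implicit, are written tens_assoc and tens_unassoc; with them, the last two *)
(* conditions read                                                            *)
(*   s ∘ (μ_C ⊗ A) = (A ⊗ μ_C) ∘ (s ⊗ C) ∘ (C ⊗ s)   on C ⊗ C ⊗ A,            *)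
(*   s ∘ (C ⊗ μ_A) = (μ_A ⊗ C) ∘ (A ⊗ s) ∘ (s ⊗ A)   on C ⊗ A ⊗ A.            *)
Definition twisting_map (k : comNzRingType) (C A : algType k)
    (s : {linear C ⊗ A -> A ⊗ C}) : Prop :=
  [/\ (forall a : A, s (1 ⊗ₜ a) = a ⊗ₜ 1) /\ (forall c : C, s (c ⊗ₜ 1) = 1 ⊗ₜ c),
      s \o tens_map tens_mul idfun
        =1 tens_map idfun tens_mul \o tens_assoc \o tens_map s idfun
             \o tens_unassoc \o tens_map idfun s \o tens_assoc
    & s \o tens_map idfun tens_mul
        =1 tens_map tens_mul idfun \o tens_unassoc \o tens_map idfun s
             \o tens_assoc \o tens_map s idfun \o tens_unassoc].

(* k[y]/<y^n>, with y the class 'qX of the variable.  The library replaces a  *)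
(* modulus of degree 0 by 'X, so this is the intended ring only for 0 < n.    *)
Notation trunc_poly k n := {poly %/ ('X^n : {poly k})}.

(* The maps gamma r j (r >= 0, j < n) attached to s; gamma r j is left        *)
(* unconstrained for j >= n.  For 0 < n they exist and are unique             *)
(* (component_funP, components_of_inj).                                       *)
Definition components_of (k : comNzRingType) (n : nat) (A : algType k)
    (s : {linear trunc_poly k n ⊗ A -> A ⊗ trunc_poly k n})
    (gamma : nat -> nat -> {linear A -> A}) : Prop :=
  (forall r a, (r < n)%N ->
     s ('qX ^+ r ⊗ₜ a) = \sum_(j < n) gamma r j a ⊗ₜ 'qX ^+ j) /\
  (forall r j a, (n <= r)%N -> (j < n)%N -> gamma r j a = 0).

Section Components.
Variables (k : comNzRingType) (n : nat) (n_gt0 : (0 < n)%N) (A : algType k).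
Local Notation C := (trunc_poly k n).

Lemma trunc_polyXn j : (j < n)%N -> ('qX ^+ j : C) = 'X^j :> {poly k}.
Proof.
move=> jn; rewrite -rmorphXn in_qpoly_small //.
by rewrite mk_monic_Xn prednK // !size_polyXn.
Qed.

Lemma size_trunc_poly (c : C) : (size (c : {poly k}) <= n)%N.
Proof.
apply: leq_trans (size_npoly c) _.
by rewrite mk_monic_Xn prednK // size_polyXn.
Qed.

Lemma trunc_polyE (c : C) : c = \sum_(j < n) (c : {poly k})`_j *: 'qX ^+ j.
Proof.
apply: val_inj; rewrite /= poly_of_qpoly_sum -[LHS](coefK c).
rewrite poly_def (big_ord_widen n (fun j => c`_j *: 'X^j)) ?size_trunc_poly //.
rewrite big_mkcond /=; apply: eq_bigr => j _.
rewrite [RHS]poly_of_qpolyZ trunc_polyXn //; case: ltnP => // cj.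
by rewrite nth_default ?scale0r.
Qed.

Definition trunc_coef_fun (j : nat) (a : A) (c : C) : A :=
  (c : {poly k})`_j *: a.

Lemma trunc_coef_fun_is_bilinear j :
  bilinear_for *:%R *:%R (trunc_coef_fun j).
Proof.
split=> [c x a a' | a x c c']; rewrite /applyr /trunc_coef_fun /=.
  by rewrite scalerDr !scalerA mulrC.
by rewrite coefD coefZ scalerDl scalerA.
Qed.

HB.instance Definition _ j := bilinear_isBilinear.Build k A C A *:%R *:%R
  (trunc_coef_fun j) (trunc_coef_fun_is_bilinear j).

Definition trunc_coef j : {linear A ⊗ C -> A} := tens_lift (trunc_coef_fun j).

Lemma trunc_coefE j a c : trunc_coef j (a ⊗ₜ c) = (c : {poly k})`_j *: a.
Proof. exact: tens_liftE. Qed.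

Lemma tens_trunc_polyE (t : A ⊗ C) :
  t = \sum_(j < n) trunc_coef j t ⊗ₜ ('qX ^+ j : C).
Proof.
have [u ut] := tens_sum t; rewrite {1}ut.
transitivity
  (\sum_(p <- u) \sum_(j < n) trunc_coef j (p.1 ⊗ₜ p.2) ⊗ₜ ('qX ^+ j : C)).
  apply: eq_bigr => p _; rewrite {1}(trunc_polyE p.2) linear_sumr /=.
  by apply: eq_bigr => j _; rewrite trunc_coefE linearZr_LR linearZl_LR.
rewrite exchange_big; apply: eq_bigr => j _ /=.
by rewrite -linear_sumlz ut linear_sum.
Qed.

Lemma trunc_coef_sum (b : nat -> A) j : (j < n)%N ->
  trunc_coef j (\sum_(i < n) b i ⊗ₜ ('qX ^+ i : C)) = b j.
Proof.
move=> jn; rewrite linear_sum (bigD1 (Ordinal jn)) //= big1 => [|i ij].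
  by rewrite addr0 trunc_coefE trunc_polyXn // coefXn eqxx scale1r.
rewrite trunc_coefE trunc_polyXn // coefXn -[j]/(val (Ordinal jn)).
by rewrite val_eqE eq_sym (negbTE ij) scale0r.
Qed.

Variable s : {linear C ⊗ A -> A ⊗ C}.

Definition component_fun (r j : nat) (a : A) : A :=
  if (r < n)%N then trunc_coef j (s ('qX ^+ r ⊗ₜ a)) else 0.

Lemma component_fun_is_linear r j : linear (component_fun r j).
Proof.
move=> c a b; rewrite /component_fun; case: ifP => _.
  by rewrite !linearPr linearP /= linearP.
by rewrite scaler0 addr0.
Qed.

HB.instance Definition _ r j := GRing.isLinear.Build k A A *:%R
  (component_fun r j) (component_fun_is_linear r j).

Lemma component_funP : components_of s component_fun.
Proof.
split=> [r a rn|r j a nr jn]; last by rewrite /= /component_fun ltnNge nr.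
by rewrite [LHS]tens_trunc_polyE /= /component_fun rn.
Qed.

Lemma components_of_inj gamma gamma' :
  components_of s gamma -> components_of s gamma' ->
  forall r j, (j < n)%N -> gamma r j =1 gamma' r j.
Proof.
move=> [sE g0] [sE' g0'] r j jn a; have [nr|rn] := leqP n r.
  by rewrite g0 ?g0'.
rewrite -(trunc_coef_sum (fun i => gamma r i a) jn).
by rewrite -(trunc_coef_sum (fun i => gamma' r i a) jn) -sE // -sE'.
Qed.

End Components.

(* Main.v *)
From mathcomp Require Import all_boot all_algebra.
Require Import Defs.

Set Implicit Arguments.
Unset Strict Implicit.
Unset Printing Implicit Defensive.

Import GRing.Theory.
Local Open Scope ring_scope.

(** Write y for the class of the variable in C = k[y]/<y^n>.  Since the powers
    of y below n form a basis of C, an identity between linear maps into A ⊗ C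
    can be tested on powers of y and compared coefficient by coefficient.
    Because y^r = 0 and gamma^r = 0 for n <= r, the formula
    s (y^r ⊗ a) = sum_j gamma^r_j(a) ⊗ y^j holds for every r, and so the axioms
    of a twisting map become four families of laws in which the exponents range
    over all natural numbers (twisting_all_laws): the two unit laws, the product
    law, and the composition law gamma^(i + r) = conv gamma^i gamma^r.  Here
    conv is the convolution of sequences of maps, that is, the product of power
    series with coefficients in End(A), so the composition law says that
    r |-> sum_j gamma^r_j Y^j is multiplicative modulo Y^n.

    The second assertion is a restriction of these laws, and the third a
    restriction of the second, apart from the product law for gamma^1 when
    n = 1, which holds because then gamma^1_0 = 0.  What remains is to recover
    all the laws from the third assertion (all_laws_of_degree1).  The recursion
    gamma^(r + 1) = conv gamma^1 gamma^r gives the composition law by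
    associativity of conv (gammaD).  The product law then follows by induction
    on r (gamma_mul):
      gamma^(r + 1)_j(ab)
        = sum_(l, i) gamma^1_l(gamma^r_i(a) gamma^i_(j - l)(b))
        = sum_(m, i, l) gamma^1_m(gamma^r_i(a)) gamma^m_l(gamma^i_(j - l)(b))
        = sum_(m, i) gamma^1_m(gamma^r_i(a)) gamma^(m + i)_j(b),
    where the terms with n <= m + i vanish, and collecting the others according
    to p = m + i leaves sum_p gamma^(r + 1)_p(a) gamma^p_j(b). *)

(** * Sums over the diagonals of a triangle *)

Section DiagonalSums.
Variables (V : nmodType) (G : nat -> nat -> V).

Lemma sum_triangle n :
  \sum_(0 <= j < n) \sum_(0 <= l < j.+1) G l (j - l)%N
    = \sum_(0 <= l < n) \sum_(0 <= m < n - l) G l m.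
Proof.
elim: n => [|n IH]; first by rewrite !big_geq.
rewrite big_nat_recr //= IH [RHS]big_nat_recr //= [X in _ + X]big_nat_recr //=.
rewrite subnn subSnn big_nat1 addrA; congr (_ + _).
rewrite -big_split /=; apply: eq_big_nat => l /andP[_ ln].
by rewrite subSn 1?ltnW // big_nat_recr.
Qed.

(** This is how truncation at y^n enters: products of two expansions in powers
    of y are sums over a square, of which only the terms below the antidiagonal
    survive. *)
Lemma sum_square_triangle n :
    (forall l m, (n <= l + m)%N -> G l m = 0) ->
  \sum_(0 <= l < n) \sum_(0 <= m < n) G l m
    = \sum_(0 <= j < n) \sum_(0 <= l < j.+1) G l (j - l)%N.
Proof.
move=> G0; rewrite sum_triangle; apply: eq_big_nat => l _.
rewrite (big_cat_nat (leq0n _) (leq_subr l n)) /= [X in _ + X]big_nat_cond.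
rewrite [X in _ + X]big1 ?addr0 // => m /andP[/andP[nm _] _].
by rewrite G0 // -leq_subLR.
Qed.

End DiagonalSums.

(** * Convolution of sequences of linear maps *)

Section Convolution.
Variables (k : comNzRingType) (A : lmodType k).
Implicit Types f g h : nat -> {linear A -> A}.

(** The coefficient of Y^j in the product of the power series sum_l f_l Y^l and
    sum_m g_m Y^m over the ring End(A), evaluated at a. *)
Definition conv f g (j : nat) (a : A) : A :=
  \sum_(0 <= l < j.+1) f l (g (j - l)%N a).

(** Both sides sum f_l (g_m (h_q a)) over l + m + q = j.  The left-hand side is
    not written with conv because conv g h is a family of bare functions rather
    than of linear maps. *)
Lemma convA f g h j a :
  \sum_(0 <= l < j.+1) f l (conv g h (j - l) a)
    = \sum_(0 <= p < j.+1) conv f g p (h (j - p)%N a).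
Proof.
pose G l m := f l (g m (h (j - (l + m))%N a)).
transitivity (\sum_(0 <= l < j.+1) \sum_(0 <= m < j.+1 - l) G l m).
  apply: eq_big_nat => l /andP[_ lj]; rewrite linear_sum subSn //.
  by apply: eq_bigr => m _; rewrite /G subnDA.
rewrite -sum_triangle; apply: eq_bigr => p _.
by apply: eq_big_nat => l /andP[_ lp]; rewrite /G subnKC.
Qed.

Lemma conv_idl f g j a :
    (forall l b, (l <= j)%N -> f l b = (l == 0%N)%:R *: b) ->
  conv f g j a = g j a.
Proof.
move=> f1; rewrite /conv big_nat_recl //= f1 // scale1r subn0.
rewrite big_nat_cond big1 ?addr0 // => l /andP[/andP[_ lj] _].
by rewrite f1 // scale0r.
Qed.

Lemma conv_idr f g j a :
    (forall l b, (l <= j)%N -> g l b = (l == 0%N)%:R *: b) ->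
  conv f g j a = f j a.
Proof.
move=> g1; rewrite /conv big_nat_recr //= subnn g1 // scale1r.
rewrite big_nat_cond big1 ?add0r // => l /andP[/andP[_ lj] _].
by rewrite g1 ?leq_subr // subn_eq0 leqNgt lj scale0r linear0.
Qed.

End Convolution.

(** * The laws for all exponents, and their generation in degree one *)

Section Laws.
Variables (k : comNzRingType) (n : nat) (A : algType k).
Variable gamma : nat -> nat -> {linear A -> A}.

(** The laws of the second assertion without the bounds on r and i, which is
    the form that both the inductions and the comparison with the axioms of a
    twisting map call for. *)
Record all_laws : Prop := AllLaws {
  law_id : forall j a, (j < n)%N -> gamma 0 j a = (j == 0%N)%:R *: a;
  law_unit : forall r j, (j < n)%N -> gamma r j 1 = (j == r)%:R;
  law_mul : forall r j a b, (j < n)%N ->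
    gamma r j (a * b) = \sum_(i < n) gamma r i a * gamma i j b;
  law_comp : forall i r j a, (j < n)%N ->
    gamma (i + r) j a = conv (gamma i) (gamma r) j a
}.

Hypothesis gamma_ge : forall r j a, (n <= r)%N -> (j < n)%N -> gamma r j a = 0.
Hypothesis gamma0 :
  forall j a, (j < n)%N -> gamma 0 j a = (j == 0%N)%:R *: a.

Lemma mul_law0 j a b : (j < n)%N ->
  gamma 0 j (a * b) = \sum_(i < n) gamma 0 i a * gamma i j b.
Proof.
move=> jn; have n0 : (0 < n)%N by apply: leq_ltn_trans jn.
rewrite (bigD1 (Ordinal n0)) //= !gamma0 // scale1r scalerAr big1 ?addr0 // => i.
by rewrite gamma0 // -val_eqE /= => /negPf->; rewrite scale0r mul0r.
Qed.

Hypothesis gamma1_1 : forall j, (j < n)%N -> gamma 1 j 1 = (j == 1%N)%:R.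
Hypothesis gamma1_mul : forall j, (j < n)%N -> forall a b,
  gamma 1 j (a * b) = \sum_(i < n) gamma 1 i a * gamma i j b.
Hypothesis gamma_rec : forall r j, (j < n)%N -> (1 < r)%N -> forall a,
  gamma r j a = conv (gamma 1) (gamma (r - 1)) j a.

Lemma gammaS r j a : (j < n)%N ->
  gamma r.+1 j a = conv (gamma 1) (gamma r) j a.
Proof.
move=> jn; case: r => [|r]; last by rewrite gamma_rec // subn1.
by rewrite conv_idr // => l b lj; apply: gamma0; apply: leq_ltn_trans lj jn.
Qed.

(** Powers of a single series multiply by adding exponents, by associativity
    of conv; the restriction to j < n is harmless since the coefficient of Y^j
    in a product involves no coefficient beyond Y^j. *)
Lemma gammaD i r j a : (j < n)%N ->
  gamma (i + r) j a = conv (gamma i) (gamma r) j a.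
Proof.
elim: i j a => [|i IH] j a jn.
  by rewrite conv_idl // => l b lj; apply: gamma0; apply: leq_ltn_trans lj jn.
rewrite addSn gammaS // /conv; under eq_big_nat => l lj.
  by rewrite IH ?(leq_ltn_trans (leq_subr _ _) jn) //; over.
rewrite convA; apply: eq_big_nat => p /andP[_ pj].
by rewrite gammaS // (leq_ltn_trans _ jn).
Qed.

(** At 1 the convolution of gamma 1 and gamma r has no nonzero term except
    possibly gamma 1 (j - r) 1, for r <= j, which is 1 if j = r + 1 and else 0. *)
Lemma gamma_unit r j : (j < n)%N -> gamma r j 1 = (j == r)%:R.
Proof.
elim: r j => [|r IH] j jn; first by rewrite gamma0 // scaler_nat.
rewrite gammaS // /conv; have [rj|jr] := leqP r j; last first.
  rewrite big_nat_cond big1 => [|l _].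
    by rewrite ltn_eqF // ltnW.
  rewrite IH ?(leq_ltn_trans (leq_subr _ _) jn) // ltn_eqF ?linear0 //.
  exact: leq_ltn_trans (leq_subr _ _) jr.
(* gamma r (j - l) 1 is 0 unless l = j - r. *)
rewrite (bigD1_seq (j - r)%N) ?iota_uniq ?mem_index_iota ?ltnS ?leq_subr //=.
rewrite subKn // IH ?(leq_ltn_trans rj) // eqxx gamma1_1;
  last exact: leq_ltn_trans (leq_subr _ _) jn.
rewrite -(eqn_add2r r) subnK // add1n big_nat_cond big1 ?addr0 //.
move=> l /andP[/andP[_ lj] ljr].
rewrite IH ?(leq_ltn_trans (leq_subr _ _) jn) //.
case: eqP => [jlr|_]; last exact: linear0.
by rewrite -jlr subKn ?eqxx // in ljr.
Qed.

(** The induction passes through a double sum over m, i < n, on which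
    gamma (m + i) vanishes as soon as n <= m + i. *)
Lemma gamma_mul r j a b : (j < n)%N ->
  gamma r j (a * b) = \sum_(i < n) gamma r i a * gamma i j b.
Proof.
elim: r j a b => [|r IH] j a b jn; first exact: mul_law0.
have lt_n l p : (p < n)%N -> (p - l < n)%N.
  exact: leq_ltn_trans (leq_subr _ _).
rewrite gammaS // /conv.
pose G m i := gamma 1 m (gamma r i a) * gamma (m + i) j b.
transitivity (\sum_(0 <= m < n) \sum_(0 <= i < n) G m i); last first.
  rewrite sum_square_triangle => [|l m nlm]; last first.
    by rewrite /G (gamma_ge _ nlm) ?mulr0.
  rewrite big_mkord; apply: eq_bigr => p _; rewrite gammaS // /conv mulr_suml.
  by apply: eq_big_nat => l /andP[_ lp]; rewrite /G subnKC.
rewrite [RHS]exchange_big_nat /= [RHS]big_mkord.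
under eq_big_nat => l /andP[_ lj].
  rewrite IH ?lt_n // linear_sum /=; under eq_bigr => i _.
    by rewrite gamma1_mul ?(leq_ltn_trans _ jn) //; over.
  by over.
rewrite exchange_big /=; apply: eq_bigr => i _.
rewrite exchange_big /= [RHS]big_mkord; apply: eq_bigr => m _.
by rewrite /G gammaD // /conv mulr_sumr.
Qed.

Lemma all_laws_of_degree1 : all_laws.
Proof.
split; [exact: gamma0 | exact: gamma_unit | exact: gamma_mul | exact: gammaD].
Qed.

End Laws.

(** * Twisting maps in the basis of powers of y *)

Section Twisting.
Variables (k : comNzRingType) (n : nat) (n_gt0 : (0 < n)%N) (A : algType k).
Local Notation C := (trunc_poly k n).
Local Notation y := ('qX : C).

Lemma qXn_eq0 r : (n <= r)%N -> y ^+ r = 0.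
Proof.
move=> nr; suff yn0 : y ^+ n = 0 by rewrite -(subnK nr) exprD yn0 mulr0.
rewrite -rmorphXn; apply: val_inj => /=.
by rewrite mk_monic_Xn prednK // Pdiv.RingMonic.rmodpp // monicXn.
Qed.

(** Valid for every r: when n <= r both sides are 0. *)
Lemma tensor_qXn r (a : A) :
  a ⊗ₜ (y ^+ r) = \sum_(j < n) ((j == r :> nat)%:R *: a) ⊗ₜ (y ^+ j).
Proof.
have [nr|rn] := leqP n r.
  rewrite qXn_eq0 // linear0r big1 // => j _.
  by rewrite ltn_eqF ?(leq_trans _ nr) // scale0r linear0l.
rewrite (bigD1 (Ordinal rn)) //= eqxx scale1r big1 ?addr0 // => j.
by rewrite -val_eqE /= => /negPf ->; rewrite scale0r linear0l.
Qed.

Lemma qXn_coef_inj (b b' : nat -> A) :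
  \sum_(j < n) b j ⊗ₜ (y ^+ j) = \sum_(j < n) b' j ⊗ₜ (y ^+ j) <->
  (forall j, (j < n)%N -> b j = b' j).
Proof.
split=> [bb' j jn|bb']; last by apply: eq_bigr => j _; rewrite bb'.
by rewrite -(trunc_coef_sum n_gt0 b jn) bb' trunc_coef_sum.
Qed.

Lemma tens_ext3l (M N P V : lmodType k) (f g : {linear (M ⊗ N) ⊗ P -> V}) :
  (forall m n p, f ((m ⊗ₜ n) ⊗ₜ p) = g ((m ⊗ₜ n) ⊗ₜ p)) -> f =1 g.
Proof.
move=> fg; apply: tens_ext => t p; have [u ->] := tens_sum t.
by rewrite linear_sumlz !linear_sum; apply: eq_bigr => x _; exact: fg.
Qed.

Lemma tens_ext3r (M N P V : lmodType k) (f g : {linear M ⊗ (N ⊗ P) -> V}) :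
  (forall m n p, f (m ⊗ₜ (n ⊗ₜ p)) = g (m ⊗ₜ (n ⊗ₜ p))) -> f =1 g.
Proof.
move=> fg; apply: tens_ext => m t; have [u ->] := tens_sum t.
by rewrite linear_sumr !linear_sum; apply: eq_bigr => x _; exact: fg.
Qed.

Variables (s : {linear C ⊗ A -> A ⊗ C}) (gamma : nat -> nat -> {linear A -> A}).
Hypothesis gammaP : components_of s gamma.

(** The expansion that defines gamma for r < n persists for n <= r, as both
    sides then vanish; it is what makes y^(i + r) harmless in twist_mul_l. *)
Lemma s_qXn r a : s ((y ^+ r) ⊗ₜ a) = \sum_(j < n) gamma r j a ⊗ₜ (y ^+ j).
Proof.
have [sE gamma_ge] := gammaP; have [nr|] := leqP n r; last exact: sE.
rewrite qXn_eq0 // linear0l linear0 big1 // => j _.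
by rewrite gamma_ge // linear0l.
Qed.

Lemma twist_one_l :
  (forall a, s (1 ⊗ₜ a) = a ⊗ₜ 1) <->
  (forall j a, (j < n)%N -> gamma 0 j a = (j == 0%N)%:R *: a).
Proof.
have E a : s (1 ⊗ₜ a) = a ⊗ₜ 1 <->
    forall j, (j < n)%N -> gamma 0 j a = (j == 0%N)%:R *: a.
  rewrite -(expr0 y) tensor_qXn s_qXn.
  exact: (qXn_coef_inj (fun j => gamma 0 j a)).
split=> [H j a jn|H a]; first by apply: (proj1 (E _)) jn; exact: H.
by apply/E => j; exact: H.
Qed.

Lemma twist_one_r :
  (forall c, s (c ⊗ₜ 1) = 1 ⊗ₜ c) <->
  (forall r j, (j < n)%N -> gamma r j 1 = (j == r)%:R).
Proof.
have E r : s ((y ^+ r) ⊗ₜ 1) = 1 ⊗ₜ (y ^+ r) <->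
    forall j, (j < n)%N -> gamma r j 1 = (j == r)%:R.
  rewrite tensor_qXn s_qXn.
  rewrite (qXn_coef_inj (gamma r ^~ 1) (fun j => (j == r)%:R *: 1)).
  by split=> H j jn; rewrite H // scaler_nat.
split=> [H r|H c]; first by apply/E; exact: H.
rewrite (trunc_polyE n_gt0 c) linear_sumlz linear_sum linear_sumr.
apply: eq_bigr => j _; rewrite linearZl_LR linearZ /= linearZr_LR.
by congr (_ *: _); apply/E => i; exact: H.
Qed.

(** The right-hand side of the compatibility of s with the product of C. *)
Definition comp_side : C ⊗ C ⊗ A -> A ⊗ C :=
  tens_map idfun tens_mul \o tens_assoc \o tens_map s idfun
    \o tens_unassoc \o tens_map idfun s \o tens_assoc.

(** Applying s twice gives the terms y^(l + m) with l, m < n; those with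
    n <= l + m are 0 and the rest are collected by degree. *)
Lemma comp_side_qXn i r a :
  comp_side (((y ^+ i) ⊗ₜ (y ^+ r)) ⊗ₜ a)
    = \sum_(j < n) conv (gamma i) (gamma r) j a ⊗ₜ (y ^+ j).
Proof.
pose G l m := gamma i l (gamma r m a) ⊗ₜ (y ^+ (l + m)).
transitivity (\sum_(0 <= l < n) \sum_(0 <= m < n) G l m).
  rewrite /comp_side /= tens_assocE tens_mapE /= s_qXn.
  rewrite linear_sumr !linear_sum /= exchange_big_nat /= big_mkord.
  apply: eq_bigr => m _; rewrite tens_unassocE tens_mapE /= s_qXn.
  rewrite linear_sumlz !linear_sum /= big_mkord; apply: eq_bigr => l _.
  by rewrite tens_assocE tens_mapE /= tens_mulE -exprD.
rewrite sum_square_triangle => [|l m nlm]; last first.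
  by rewrite /G qXn_eq0 // linear0r.
rewrite big_mkord; apply: eq_bigr => j _; rewrite /conv linear_sumlz.
by apply: eq_big_nat => l /andP[_ lj]; rewrite /G subnKC.
Qed.

(** Compatibility with the product of C is the composition law because
    y^i y^r = y^(i + r). *)
Lemma twist_mul_l :
  s \o tens_map tens_mul idfun =1 comp_side <->
  (forall i r j a, (j < n)%N -> gamma (i + r) j a = conv (gamma i) (gamma r) j a).
Proof.
have E i r a : (s \o tens_map tens_mul idfun) (((y ^+ i) ⊗ₜ (y ^+ r)) ⊗ₜ a)
      = comp_side (((y ^+ i) ⊗ₜ (y ^+ r)) ⊗ₜ a) <->
    forall j, (j < n)%N -> gamma (i + r) j a = conv (gamma i) (gamma r) j a.
  rewrite comp_side_qXn /= tens_mapE /= tens_mulE -exprD s_qXn.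
  exact: (qXn_coef_inj (fun j => gamma (i + r) j a)).
split=> [H i r j a|H]; first by move=> jn; apply: (proj1 (E _ _ _)) jn; exact: H.
apply: tens_ext3l => c c' a.
rewrite (trunc_polyE n_gt0 c) (trunc_polyE n_gt0 c').
rewrite linear_sumlz linear_sumlz !linear_sum; apply: eq_bigr => i _.
rewrite linear_sumr linear_sumlz !linear_sum; apply: eq_bigr => r _.
rewrite !(linearZl_LR, linearZr_LR) !linearZ; do 2 congr (_ *: _).
by apply/E => j; exact: H.
Qed.

(** The right-hand side of the compatibility of s with the product of A. *)
Definition mul_side : C ⊗ (A ⊗ A) -> A ⊗ C :=
  tens_map tens_mul idfun \o tens_unassoc \o tens_map idfun s
    \o tens_assoc \o tens_map s idfun \o tens_unassoc.

Lemma mul_side_qXn r a b :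
  mul_side ((y ^+ r) ⊗ₜ (a ⊗ₜ b))
    = \sum_(j < n) (\sum_(i < n) gamma r i a * gamma i j b) ⊗ₜ (y ^+ j).
Proof.
rewrite /mul_side /= tens_unassocE tens_mapE /= s_qXn.
rewrite linear_sumlz !linear_sum /=; under [RHS]eq_bigr do rewrite linear_sumlz.
rewrite exchange_big; apply: eq_bigr => i _ /=.
rewrite tens_assocE tens_mapE /= s_qXn linear_sumr !linear_sum /=.
by apply: eq_bigr => j _; rewrite tens_unassocE tens_mapE /= tens_mulE.
Qed.

Lemma twist_mul_r :
  s \o tens_map idfun tens_mul =1 mul_side <->
  (forall r j a b, (j < n)%N ->
     gamma r j (a * b) = \sum_(i < n) gamma r i a * gamma i j b).
Proof.
have E r a b : (s \o tens_map idfun tens_mul) ((y ^+ r) ⊗ₜ (a ⊗ₜ b))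
      = mul_side ((y ^+ r) ⊗ₜ (a ⊗ₜ b)) <->
    forall j, (j < n)%N ->
      gamma r j (a * b) = \sum_(i < n) gamma r i a * gamma i j b.
  rewrite mul_side_qXn /= tens_mapE /= tens_mulE s_qXn.
  exact: (qXn_coef_inj (fun j => gamma r j (a * b))
            (fun j => \sum_(i < n) gamma r i a * gamma i j b)).
split=> [H r j a b|H]; first by move=> jn; apply: (proj1 (E _ _ _)) jn; exact: H.
apply: tens_ext3r => c a b; rewrite (trunc_polyE n_gt0 c) linear_sumlz !linear_sum.
apply: eq_bigr => r _; rewrite linearZl_LR !linearZ; congr (_ *: _).
by apply/E => j; exact: H.
Qed.

Lemma twisting_all_laws : twisting_map s <-> all_laws n gamma.
Proof.
split=> [[[/twist_one_l ? /twist_one_r ?] /twist_mul_l ? /twist_mul_r ?]|] //.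
case=> /twist_one_l ? /twist_one_r ? /twist_mul_r ? /twist_mul_l ?.
by split.
Qed.

End Twisting.

Theorem proposition1p2 (k : comNzRingType) (n : nat) (n_gt0 : (0 < n)%N)
    (A : algType k) (s : {linear trunc_poly k n ⊗ A -> A ⊗ trunc_poly k n})
    (gamma : nat -> nat -> {linear A -> A})
    (gammaP : components_of s gamma) :
  [<->
    twisting_map s;

    [/\ forall j a, (j < n)%N -> gamma 0%N j a = (j == 0%N)%:R *: a,
        forall r j, (j < n)%N -> gamma r j 1 = (j == r)%:R,
        forall r j, (j < n)%N -> (0 < r < n)%N -> forall a b,
          gamma r j (a * b) = \sum_(i < n) gamma r i a * gamma i j b
      & forall r i j, (j < n)%N -> (1 < r)%N -> (0 < i < r)%N -> forall a,
          gamma r j a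
            = \sum_(0 <= l < j.+1) gamma i l (gamma (r - i)%N (j - l)%N a)];

    [/\ forall j a, (j < n)%N -> gamma 0%N j a = (j == 0%N)%:R *: a,
        forall j, (j < n)%N -> gamma 1%N j 1 = (j == 1%N)%:R,
        forall j, (j < n)%N -> forall a b,
          gamma 1%N j (a * b) = \sum_(i < n) gamma 1%N i a * gamma i j b
      & forall r j, (j < n)%N -> (1 < r)%N -> forall a,
          gamma r j a
            = \sum_(0 <= l < j.+1) gamma 1%N l (gamma (r - 1)%N (j - l)%N a)]].
Proof.
have [_ gamma_ge] := gammaP.
tfae.
- case/(twisting_all_laws n_gt0 gammaP) => id1 unit mul comp; split=> //.
  + by move=> r j jn _ a b; exact: mul.
  + move=> r i j jn _ /andP[_ ir] a.
    by rewrite -[in LHS](subnKC (ltnW ir)) comp.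
- case=> id1 unit mul comp; split=> // [j jn|j jn a b|r j jn r1 a].
  + exact: unit.
    (* For n = 1 no r satisfies 0 < r < n, but then gamma 1 0 = 0. *)
  + have [n1|n1] := ltnP 1 n; first exact: mul.
    by rewrite gamma_ge // big1 // => i _; rewrite gamma_ge ?mul0r.
  + exact: comp.
- case=> id1 unit mul comp; apply/(twisting_all_laws n_gt0 gammaP).
  exact: all_laws_of_degree1.
Qed.
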